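(* Let $N,S$ be positive integers and let $e_n(s)\in\{-1,+1\}$ ($1\le n\le N$, $1\le s\le S$) be chosen independently and uniformly at random; put $G_{N,S}(s)=(e_1(s),\dots,e_N(s))$. For any fixed constant $\varepsilon>0$ and any integer function $k=k(N)$ with $2\le k\le (\log N+\log S)/\log\log N$, there is a constant $N_0\ge 12\log_2 S$ such that for all $N\ge N_0$ the probability that \[ 1-\varepsilon<\frac{\Phi_k(G_{N,S})}{\mathbb{E}[\Phi_k(G_{N,S})]}<1+\varepsilon \] holds is at least $1-\varepsilon$.
   Context: For a map $G_{N,S}:\{1,\dots,S\}\to\{-1,+1\}^N$, $G_{N,S}(s)=(e_1(s),\dots,e_N(s))$, the cross-correlation measure of order $k$ is \[ \Phi_k(G_{N,S})=\max\left|\sum_{n=1}^M e_{n+d_1}(s_1)\cdots e_{n+d_k}(s_k)\right|, \] the maximum taken over all integers $M,d_1,\dots,d_k$ and $1\le s_1,\dots,s_k\le S$ with $0\le d_1\le d_2\le\dots\le d_k<M+d_k\le N$ and $d_i\ne d_j$ whenever $s_i=s_j$. $\log$ denotes the natural logarithm. *)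

(* Defs.v *)
From mathcomp Require Import all_boot all_order all_algebra.
From mathcomp Require Import reals exp.
Set Implicit Arguments. Unset Strict Implicit. Unset Printing Implicit Defensive.
Import Order.TTheory GRing.Theory Num.Theory.
Local Open Scope ring_scope.

(* A signfam G_{N,S} is encoded as w : {ffun 'I_S * 'I_N -> bool}:
   e_{n+1}(s+1) = +1 if w (s, n) is true, -1 otherwise (0-based indices). *)
Definition signfam (N S : nat) := {ffun 'I_S * 'I_N -> bool}.

(* e at (0-based) position m of the sequence number s, as an integer;
   positions m >= N never occur below (value 0, irrelevant). *)
Definition esign (N S : nat) (w : signfam N S) (s : 'I_S) (m : nat) : int :=
  match insub m with
  | Some i => if w (s, i) then 1 else -1
  | None => 0
  end.

(* A configuration (M, d_1..d_k, s_1..s_k) with 0-based i : 'I_k. *)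
Definition config (N S k : nat) :=
  ('I_N.+1 * {ffun 'I_k -> 'I_N} * {ffun 'I_k -> 'I_S})%type.

Definition admissible (N S k : nat) (c : config N S k) : bool :=
  let: (M, d, s) := c in
  [&& (0 < M)%N,
      [forall i : 'I_k, forall j : 'I_k, (i <= j)%N ==> (d i <= d j)%N],
      [forall i : 'I_k, (M + d i <= N)%N] &
      [forall i : 'I_k, forall j : 'I_k,
         ((i != j) && (s i == s j)) ==> (d i != d j)]].

Definition corr_sum (N S k : nat) (w : signfam N S) (c : config N S k) : int :=
  let: (M, d, s) := c in
  \sum_(n < M) \prod_(i < k) esign w (s i) (n + d i)%N.

Definition Phi (N S k : nat) (w : signfam N S) : nat :=
  \max_(c : config N S k | admissible c) absz (corr_sum w c).

Definition expect (R : realType) (N S : nat) (X : signfam N S -> R) : R :=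
  (\sum_(w : signfam N S) X w) / #|{: signfam N S}|%:R.

Definition prob (R : realType) (N S : nat) (P : pred (signfam N S)) : R :=
  #|[set w : signfam N S | P w]|%:R / #|{: signfam N S}|%:R.

(* Main.v *)
(* Flipping one of the S N signs changes Phi_k by at most 2 k, so Var Phi_k <= S N k^2,
   and Chebyshev's inequality reduces the claim to E[Phi_k]^2 >> N k^2.  For this one needs
   E[Phi_k] >= c sqrt (N k log N), which wins because k = o(log N).

   Take one sequence, d_1 = 0, and d_2 < ... < d_k in consecutive blocks of length about
   sqrt N beyond the window [0, M), M = r q.  For two different choices of the d_i, the
   2 M products e_{n+d_1} ... e_{n+d_k} (n < M) are jointly uniform signs: in any nonempty
   subproduct some sign occurs an odd number of times.  With r of order k log N, a fourth
   moment bound shows that for a given choice all r consecutive partial sums of length q are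
   at least sqrt q / 2 with probability at least 16^-r; these events are pairwise independent
   and there are at least 4 * 16^r of them, so by the second moment method one of them occurs
   with probability at least 3/4, and then Phi_k >= r sqrt q / 2, of order sqrt (N k log N). *)
Require Import Defs.
From mathcomp Require Import all_boot all_order all_algebra.
From mathcomp Require Import reals sequences exp zify ring lra.
Set Implicit Arguments. Unset Strict Implicit. Unset Printing Implicit Defensive.
Import Order.TTheory GRing.Theory Num.Theory.
Local Open Scope ring_scope.

(** * Means over a finite set, Chebyshev's inequality, the second moment method *)

Definition mean {R : realFieldType} {W : finType} (f : W -> R) : R :=
  (\sum_w f w) / #|W|%:R.

Section Mean.
Context {R : realFieldType} {W : finType}.
Implicit Types (f g : W -> R) (c t : R).

Lemma eq_mean f g : f =1 g -> mean f = mean g.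
Proof. by move=> fg; rewrite /mean (eq_bigr g). Qed.

Lemma meanD f g : mean (fun w => f w + g w) = mean f + mean g.
Proof. by rewrite /mean big_split mulrDl. Qed.

Lemma meanZ c f : mean (fun w => c * f w) = c * mean f.
Proof. by rewrite /mean -mulr_sumr mulrA. Qed.

Lemma mean_sum (X : finType) (F : X -> W -> R) :
  mean (fun w => \sum_x F x w) = \sum_x mean (F x).
Proof. by rewrite /mean exchange_big mulr_suml. Qed.

Lemma mean_cst c : (0 < #|W|)%N -> mean (fun _ : W => c) = c.
Proof.
move=> W0; rewrite /mean sumr_const -[c *+ _]mulr_natr mulfK //.
by rewrite pnatr_eq0 -lt0n.
Qed.

Lemma ler_mean f g : (forall w, f w <= g w) -> mean f <= mean g.
Proof. by move=> fg; apply: ler_wpM2r; rewrite ?invr_ge0 ?ler0n// ler_sum. Qed.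

Lemma mean_ge0 f : (forall w, 0 <= f w) -> 0 <= mean f.
Proof. by move=> f0; rewrite /mean divr_ge0 ?ler0n// sumr_ge0. Qed.

Lemma mean_bij (h : W -> W) f : injective h -> mean (fun w => f (h w)) = mean f.
Proof.
move=> hi; rewrite /mean; congr (_ / _).
by rewrite [RHS](reindex_inj hi).
Qed.

(** Pointwise, with [E] the mean, the indicator is at least [1 - (f w - E) ^+ 2 / t ^+ 2]; then
    average. *)
Lemma chebyshev f t : (0 < #|W|)%N -> 0 < t ->
  1 - (mean (fun w => f w ^+ 2) - mean f ^+ 2) / t ^+ 2
    <= mean (fun w => (`|f w - mean f| < t)%R%:R).
Proof.
move=> W0 t0; set E := mean f.
have -> : mean (fun w => f w ^+ 2) - E ^+ 2 = mean (fun w => (f w - E) ^+ 2).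
  transitivity (mean (fun w => f w ^+ 2 + (- (E + E) * f w + E ^+ 2))); last first.
    by apply: eq_mean => w; ring.
  rewrite !meanD meanZ mean_cst// -/E; ring.
rewrite -{1}(mean_cst 1 W0) mulrC -meanZ -mulN1r -meanZ -meanD.
apply: ler_mean => w; case: ltP => [_|tf] /=.
  by rewrite gerDl mulN1r oppr_le0 mulr_ge0 ?sqr_ge0// invr_ge0 sqr_ge0.
rewrite mulN1r subr_le0 ler_pdivlMl ?exprn_gt0// mulr1 -(real_normK (num_real (f w - E))).
by rewrite ler_pXn2r// ?nnegrE ?ltW// (lt_le_trans t0).
Qed.

(** Let [mu] be the expected number of events. Where no event occurs the centred count is [- mu], so
    [mu ^+ 2] times that indicator is at most the squared centred count, whose mean is at most [mu]
    because covariances of distinct events vanish. *)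
Lemma second_moment (X : finType) (B : X -> pred W) (P : R) : (0 < #|W|)%N ->
  (forall x, mean (fun w => (B x w)%:R) = P) ->
  (forall x y, x != y -> mean (fun w => (B x w && B y w)%:R) = P ^+ 2) ->
  #|X|%:R * P * mean (fun w => [forall x, ~~ B x w]%:R) <= 1.
Proof.
move=> W0 BP BB; set mu := #|X|%:R * P.
have [->|X0] := eqVneq mu 0; first by rewrite mul0r ler01.
have [x0 _|/eq_card0 Xe] := pickP (@predT X); last by rewrite /mu Xe mul0r eqxx in X0.
have P0 : 0 <= P by rewrite -(BP x0) mean_ge0.
have mu0 : 0 < mu by rewrite lt_def X0 mulr_ge0.
have var : mean (fun w => (\sum_x ((B x w)%:R - P)) ^+ 2) <= mu.
  have -> : mean (fun w => (\sum_x ((B x w)%:R - P)) ^+ 2) =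
     \sum_x \sum_y mean (fun w => (B x w && B y w)%:R
                         + (- P * (B x w)%:R + (- P * (B y w)%:R + P ^+ 2))).
    under [RHS]eq_bigr do rewrite -mean_sum.
    rewrite -mean_sum; apply: eq_mean => w; rewrite expr2 mulr_suml.
    apply: eq_bigr => x _; rewrite mulr_sumr; apply: eq_bigr => y _.
    by rewrite -mulnb natrM; ring.
  rewrite /mu -sum1_card natr_sum mulr_suml; apply: ler_sum => x _.
  rewrite (bigD1 x)//= big1 => [|y yx].
    rewrite !meanD mean_cst// !meanZ.
    under eq_mean do rewrite andbb.
    by have := sqr_ge0 P; rewrite BP; lra.
  by rewrite !meanD mean_cst// !meanZ !BP BB 1?eq_sym//; ring.
rewrite -(ler_pM2l mu0) mulr1 mulrA -expr2 -meanZ; apply: le_trans var.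
apply: ler_mean => w; case: forallP => [nB|_]; last by rewrite mulr0 sqr_ge0.
rewrite mulr1 -[leRHS]sqrrN; suff -> : - \sum_x ((B x w)%:R - P) = mu by [].
rewrite -sumrN /mu -sum1_card natr_sum mulr_suml; apply: eq_bigr => x _.
by rewrite (negbTE (nB x)) sub0r opprK mul1r.
Qed.

End Mean.

(** * The sign cube and the variance of functions with bounded increments *)

Definition sgb {R : pzRingType} (b : bool) : R := if b then 1 else -1.

Definition flip {I : finType} (i : I) (w : {ffun I -> bool}) : {ffun I -> bool} :=
  [ffun j => w j (+) (j == i)].

Section Cube.
Context {R : realFieldType}.
Implicit Types I J K : finType.

Lemma sgb_sqr b : (sgb b : R) ^+ 2 = 1.
Proof. by case: b; rewrite /sgb ?sqrrN expr1n. Qed.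

Lemma sgb_negb b : sgb (~~ b) = - sgb b :> R.
Proof. by case: b; rewrite /sgb ?opprK. Qed.

Lemma sgb_eq b c : (b == c)%:R = (1 + sgb b * sgb c) / 2 :> R.
Proof. by case: b; case: c; rewrite /sgb /=; lra. Qed.

Lemma flip_inj I (i : I) : injective (flip i).
Proof.
move=> w w' e; apply/ffunP => j; have := congr1 (fun v : {ffun I -> bool} => v j) e.
by rewrite !ffunE => /addIb.
Qed.

Lemma cube_gt0 I : (0 < #|{ffun I -> bool}|)%N.
Proof. by rewrite card_ffun card_bool expn_gt0. Qed.

Lemma mean_odd I i (f : {ffun I -> bool} -> R) :
  (forall w, f (flip i w) = - f w) -> mean f = 0.
Proof.
move=> fo; have := mean_bij f (@flip_inj I i).
rewrite (eq_mean (g := fun w => -1 * f w)) ?meanZ; first by lra.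
by move=> w; rewrite fo mulN1r.
Qed.

(** The conditional expectation of [f] given the coordinates outside [s]. *)
Fixpoint avg I (s : seq I) (f : {ffun I -> bool} -> R) w : R :=
  if s is i :: s' then (avg s' f w + avg s' f (flip i w)) / 2 else f w.

Lemma flipC I (i j : I) w : flip i (flip j w) = flip j (flip i w).
Proof. by apply/ffunP => l; rewrite !ffunE addbAC. Qed.

(** Flips commute, so an increment of the average is an average of increments. *)
Lemma avg_lip I (s : seq I) f (c : R) : (forall i w, `|f w - f (flip i w)| <= c) ->
  forall i w, `|avg s f w - avg s f (flip i w)| <= c.
Proof.
move=> fc; elim: s => //= j s IH i w; rewrite -flipC.
have /ler_normlP[h1 h2] := IH i w; have /ler_normlP[h3 h4] := IH i (flip j w).
by apply/ler_normlP; split; lra.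
Qed.

Lemma avg_agree I (s : seq I) f (w w' : {ffun I -> bool}) :
  (forall i, i \notin s -> w i = w' i) -> avg s f w = avg s f w'.
Proof.
elim: s w w' => [|i s IH] w w' ww /=; first by congr f; apply/ffunP => i; exact: ww.
have agree (v v' : {ffun I -> bool}) : v i = v' i -> (forall j, j \notin i :: s -> v j = v' j) ->
    forall j, j \notin s -> v j = v' j.
  move=> vi vv j js; have [->//|ji] := eqVneq j i.
  by apply: vv; rewrite inE negb_or ji.
have flipi (v v' : {ffun I -> bool}) : (forall j, j \notin i :: s -> v j = v' j) ->
    forall j, j \notin i :: s -> v j = flip i v' j.
  move=> vv j js; rewrite ffunE (vv j js).
  by move: js; rewrite inE negb_or => /andP[/negbTE->]; rewrite addbF.
have [wi|wi] := eqVneq (w i) (w' i).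
  rewrite (IH w w'); last exact: agree.
  rewrite (IH (flip i w) (flip i w')) // => j js.
  by rewrite !ffunE (agree w w').
(* Since [w] and [w'] differ at [i], the two terms of the average correspond crosswise. *)
rewrite addrC (IH w (flip i w')); last first.
  apply: agree; last exact: flipi.
  by rewrite ffunE eqxx; move: wi; case: (w i); case: (w' i).
rewrite (IH (flip i w) w') // => j js.
have [->|ji] := eqVneq j i.
  by rewrite ffunE eqxx; move: wi; case: (w i); case: (w' i).
by rewrite ffunE (negbTE ji) addbF ww// inE negb_or ji.
Qed.

Lemma mean_avg_sqr I (s : seq I) f (c : R) : (forall i w, `|f w - f (flip i w)| <= c) ->
  mean f = mean (avg s f) /\
  mean (fun w => f w ^+ 2) <= mean (fun w => avg s f w ^+ 2) + (size s)%:R * (c ^+ 2 / 4).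
Proof.
move=> fc; elim: s => [|i s [IH1 IH2]] /=; first by rewrite mul0r addr0.
set g := avg s f in IH1 IH2 *; have gi (h : _ -> R) := mean_bij h (@flip_inj I i).
split.
  rewrite [RHS](eq_mean (g := fun w => 1/2 * g w + 1/2 * g (flip i w))) => [|w /=]; last by field.
  by rewrite meanD !meanZ (gi g) IH1; field.
apply: le_trans IH2 _; rewrite -[(size s).+1%:R]natr1 mulrDl mul1r addrA addrAC lerD2r.
have -> : mean (fun w => g w ^+ 2) =
    mean (fun w => 1/2 * g w ^+ 2 + 1/2 * g (flip i w) ^+ 2).
  by rewrite meanD !meanZ (gi (fun w => g w ^+ 2)); field.
rewrite -[X in _ <= _ + X](mean_cst _ (cube_gt0 I)) -meanD; apply: ler_mean => w.
(* The loss in one averaging step is [(a ^+ 2 + b ^+ 2) / 2 - ((a + b) / 2) ^+ 2 = (a - b) ^+ 2 /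
   4]. *)
have := avg_lip s fc i w; rewrite -/g.
set a := g w; set b := g _ => ab.
have : (a - b) ^+ 2 <= c ^+ 2.
  by rewrite -(real_normK (num_real (a - b))) ler_pXn2r// nnegrE (le_trans _ ab).
by rewrite -subr_ge0; nra.
Qed.

(* Averaging over one coordinate lowers the second moment by at most [c ^ 2 / 4]
   and keeps all increments below [c]; averaging over all leaves a constant. *)
Lemma variance_bound I (f : {ffun I -> bool} -> R) (c : R) :
  (forall i w, `|f w - f (flip i w)| <= c) ->
  mean (fun w => f w ^+ 2) - mean f ^+ 2 <= #|I|%:R * (c ^+ 2 / 4).
Proof.
move=> fc; have [E1 E2] := mean_avg_sqr (enum I) fc.
pose w0 : {ffun I -> bool} := [ffun=> true].
have cst w : avg (enum I) f w = avg (enum I) f w0.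
  by apply: avg_agree => i; rewrite mem_enum.
have E3 : mean (avg (enum I) f) = avg (enum I) f w0.
  by rewrite (eq_mean cst) mean_cst ?cube_gt0.
have E4 : mean (fun w => avg (enum I) f w ^+ 2) = avg (enum I) f w0 ^+ 2.
  rewrite -[RHS](mean_cst _ (cube_gt0 I)); apply: eq_mean => w.
  by rewrite cst.
by rewrite lerBlDl cardE (le_trans E2)// E4 E1 E3.
Qed.
End Cube.

(** * Joint uniformity of signs and independence of rows *)

Section Uniformity.
Context {R : realFieldType}.
Implicit Types I J A B : finType.

(* Expand the indicator of [Y = y] in characters; only the trivial one has a
   nonzero mean. *)
Lemma mean_uniform I J (Y : J -> {ffun I -> bool} -> bool) (G : pred {ffun J -> bool}) :
  (forall X : {set J}, X != set0 -> mean (fun w => \prod_(j in X) sgb (Y j w) : R) = 0) ->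
  mean (fun w => (G [ffun j => Y j w])%:R) = mean (fun y => (G y)%:R) :> R.
Proof.
move=> Y0.
have point y : mean (fun w => ([ffun j => Y j w] == y)%:R) =
    (#|{ffun J -> bool}|%:R)^-1 :> R.
  pose c (X : {set J}) : R := 2^-1 ^+ #|J| * \prod_(j in X) sgb (y j).
  rewrite (eq_mean (g := fun w => \sum_(X : {set J}) c X * \prod_(j in X) sgb (Y j w))).
    rewrite mean_sum (bigD1 set0)//= big1 => [|X X0]; last by rewrite meanZ Y0 ?mulr0.
    rewrite meanZ /c big_set0 (eq_mean (g := fun=> 1)) => [|w]; last by rewrite big_set0.
    by rewrite mean_cst ?cube_gt0// !mulr1 addr0 card_ffun card_bool natrX exprVn.
  move=> w; transitivity (\prod_j ((Y j w == y j)%:R : R)).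
    case: eqP => [<-|ne]; first by rewrite big1 // => j _; rewrite ffunE eqxx.
    have [|eqY] := boolP [exists j, Y j w != y j].
      by case/existsP => j /negbTE nej; rewrite (bigD1 j)//= nej mul0r.
    case: ne; apply/ffunP => j; rewrite ffunE; apply/eqP.
    by move: eqY; rewrite negb_exists => /forallP/(_ j); rewrite negbK.
  under eq_bigr do rewrite sgb_eq addrC.
  rewrite big_split /= prodr_const bigA_distr mulr_suml; apply: eq_bigr => X _.
  rewrite /c -mulrA mulrC cardT -cardE; congr (_ * _).
  by rewrite -big_mkcond -big_split; apply: eq_bigr => j _; rewrite mulrC.
rewrite (eq_mean (g := fun w => \sum_y (G y)%:R * ([ffun j => Y j w] == y)%:R)).
  rewrite mean_sum /mean mulr_suml; apply: eq_bigr => y _.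
  by rewrite -/(mean _) meanZ point.
move=> w; rewrite (bigD1 [ffun j => Y j w])//= eqxx mulr1 big1 ?addr0// => y.
by rewrite eq_sym => /negbTE->; rewrite mulr0.
Qed.

(** Currying makes a uniform array a uniform tuple of rows, and summing a product over all tuples
    gives the product of the row sums. *)
Lemma mean_forall_rows A B (G : pred {ffun B -> bool}) :
  mean (fun y : {ffun A * B -> bool} => [forall a, G [ffun b => y (a, b)]]%:R)
  = mean (fun v => (G v)%:R) ^+ #|A| :> R.
Proof.
rewrite /mean expr_div_n -natrX; congr (_ / _); last first.
  by rewrite !card_ffun card_prod card_bool mulnC expnM.
pose h (f : {ffun A -> {ffun B -> bool}}) : {ffun A * B -> bool} := [ffun ab => f ab.1 ab.2].
pose h' (y : {ffun A * B -> bool}) : {ffun A -> {ffun B -> bool}} :=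
  [ffun a => [ffun b => y (a, b)]].
rewrite (reindex h); last first.
  exists h' => [f _|y _]; first by apply/ffunP => a; apply/ffunP => b; rewrite !ffunE.
  by apply/ffunP => -[a b]; rewrite !ffunE.
transitivity (\sum_(f : {ffun A -> {ffun B -> bool}}) \prod_a ((G (f a))%:R : R)).
  apply: eq_bigr => f _.
  have hf a : [ffun b => h f (a, b)] = f a by apply/ffunP => b; rewrite !ffunE.
  case: forallP => [Gf|nG]; first by rewrite big1 // => a _; rewrite -hf Gf.
  have [|/existsPn Gf] := boolP [exists a, ~~ G (f a)].
    by case/existsP => a /negbTE Ga; rewrite (bigD1 a)//= Ga mul0r.
  by case: nG => a; rewrite hf; have := Gf a; rewrite negbK.
by rewrite -(bigA_distr_bigA (fun=> fun v => (G v)%:R)) prodr_const.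
Qed.

End Uniformity.

(** * A sum of random signs is large with probability bounded below *)

Section SmallBall.
Context {R : rcfType} {I : finType}.
Implicit Types (y : {ffun I -> bool}) (s : seq I).

Let X s y : R := \sum_(i <- s) sgb (y i).

Lemma sum_sgb_flip i s y : i \notin s -> X s (flip i y) = X s y.
Proof.
move=> si; apply: eq_big_seq => j js; rewrite ffunE; case: eqP => [ji|_]; last by rewrite addbF.
by rewrite -ji js in si.
Qed.

(** Expand the power of the new sign plus the old sum: odd powers of the new sign have mean zero
    because flipping [i] leaves the old sum unchanged. *)
Lemma mean_sum_sgb24 s : uniq s ->
  mean (fun y => X s y ^+ 2) = (size s)%:R /\
  mean (fun y => X s y ^+ 4) = 3 * (size s)%:R ^+ 2 - 2 * (size s)%:R.
Proof.
elim: s => [_|i s IH /= /andP[si /IH[m2 m4]]].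
  rewrite !(eq_mean (g := fun=> 0)) => [|y|y]; try by rewrite /X big_nil expr0n.
  by rewrite mean_cst ?cube_gt0//= mulr0 expr0n /= mulr0 subrr.
have sgi y : sgb (flip i y i) = - sgb (y i) :> R by rewrite ffunE eqxx addbT sgb_negb.
have odd k : mean (fun y => sgb (y i) * X s y ^+ k) = 0.
  by apply: (@mean_odd _ _ i) => y; rewrite sgi sum_sgb_flip// mulNr.
have S2 y := @sgb_sqr R (y i).
split.
  rewrite (eq_mean (g := fun y => X s y ^+ 2 + (2 * (sgb (y i) * X s y ^+ 1) + 1))).
    by rewrite !meanD meanZ odd m2 mean_cst ?cube_gt0// mulr0 add0r natr1.
  by move=> y; rewrite /X big_cons -/(X s y) sqrrD S2; ring.
rewrite (eq_mean (g := fun y => X s y ^+ 4 + (6 * X s y ^+ 2 +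
   (4 * (sgb (y i) * X s y ^+ 1) + (4 * (sgb (y i) * X s y ^+ 3) + 1))))).
  rewrite !meanD !meanZ !odd m2 m4 mean_cst ?cube_gt0// -natr1; ring.
move=> y; rewrite /X big_cons -/(X s y).
have -> : (sgb (y i) + X s y) ^+ 4 = (sgb (y i) ^+ 2) ^+ 2 + X s y ^+ 4
  + 4 * (sgb (y i) ^+ 2 * sgb (y i) * X s y) + 6 * (sgb (y i) ^+ 2 * X s y ^+ 2)
  + 4 * (sgb (y i) * X s y ^+ 3) by ring.
by rewrite S2; ring.
Qed.

Lemma small_ball : (0 < #|I|)%N ->
  1/16 <= mean (fun y => (Num.sqrt #|I|%:R / 2 <= \sum_i sgb (y i) :> R)%R%:R) :> R.
Proof.
move=> I0; set p := mean _.
pose neg y : {ffun I -> bool} := [ffun i => ~~ y i].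
have neg_inj : injective neg.
  by move=> y z /ffunP e; apply/ffunP => i; have := e i; rewrite !ffunE => /negb_inj.
have Xneg y : \sum_i sgb (neg y i) = - \sum_i sgb (y i) :> R.
  by rewrite -sumrN; apply: eq_bigr => i _; rewrite ffunE sgb_negb.
have pneg : mean (fun y => (Num.sqrt #|I|%:R / 2 <= - \sum_i sgb (y i) :> R)%R%:R) = p.
  by rewrite -[RHS](mean_bij _ neg_inj); apply: eq_mean => y; rewrite Xneg.
have [m2 m4] := mean_sum_sgb24 (enum_uniq I).
rewrite -cardE in m2 m4; set Q : R := #|I|%:R in m2 m4 p pneg *.
have Q0 : 0 < Q by rewrite ltr0n.
have h2 : Num.sqrt Q ^+ 2 = Q by rewrite sqr_sqrtr// ltW.
have hp : 0 <= Num.sqrt Q by rewrite sqrtr_ge0.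
(* With [x] the sum, [8 Q x^2 - x^4 - 2 Q^2] is at most [14 Q^2] everywhere (equality at
   [x^2 = 4 Q]) and at most 0 when [4 x^2 <= Q]. Its mean is [3 Q^2 + 2 Q], so the two symmetric
   tails give [2 p >= 3/14], more than enough for [1/16]. *)
suff : 8 * Q * Q - (3 * Q ^+ 2 - 2 * Q) - 2 * Q ^+ 2 <= 14 * Q ^+ 2 * (p + p).
  move=> H; rewrite -(ler_pM2l (exprn_gt0 2 Q0)). nra.
have -> : 8 * Q * Q - (3 * Q ^+ 2 - 2 * Q) - 2 * Q ^+ 2 =
    mean (fun y => 8 * Q * X (enum I) y ^+ 2 + (-1 * X (enum I) y ^+ 4 + - (2 * Q ^+ 2))).
  by rewrite !meanD !meanZ m2 m4 mean_cst ?cube_gt0//; ring.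
rewrite -{2}pneg /p -meanD -meanZ.
apply: ler_mean => y; rewrite /X big_enum /=; set x := \sum_i _.
have top : 8 * Q * x ^+ 2 + (-1 * x ^+ 4 + - (2 * Q ^+ 2)) <= 14 * Q ^+ 2.
  by have := sqr_ge0 (x ^+ 2 - 4 * Q); nra.
have Q20 : 0 <= 14 * Q ^+ 2 by rewrite mulr_ge0// sqr_ge0.
case: (leP _ x) => hx; case: (leP _ (- x)) => hx' /=.
- by rewrite (le_trans top)// ler_peMr//; lra.
- by rewrite (le_trans top)// ler_peMr//; lra.
- by rewrite (le_trans top)// ler_peMr//; lra.
have x2 : 4 * x ^+ 2 <= Q by rewrite -h2; nra.
rewrite addr0 mulr0; have := sqr_ge0 (x ^+ 2); nra.
Qed.

End SmallBall.

(** * Effect of one sign flip on the correlation measure *)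

Section Flip.
Context {N S : nat}.
Implicit Types w : signfam N S.

Lemma esign_flip w (s : 'I_S) (m : 'I_N) (t : 'I_S) (p : nat) :
  esign (flip (s, m) w) t p = (-1) ^+ ((t == s) && (p == m)) * esign w t p.
Proof.
rewrite /esign; case: insubP => [i _ <-|_]; last by rewrite mulr0.
rewrite ffunE xpair_eqE (_ : (nat_of_ord i == m) = (i == m))//.
by case: (_ && _); rewrite ?addbF ?mul1r// addbT expr1 mulN1r; case: (w _); rewrite ?opprK.
Qed.

Lemma esign_sqr w t p : (p < N)%N -> esign w t p ^+ 2 = 1.
Proof. by rewrite /esign; case: insubP => [i _ _|/negbTE->//]; case: (w _). Qed.

Lemma normr_esign w t p : `|esign w t p| <= 1.
Proof. by rewrite /esign; case: insubP => [i _ _|//]; case: (w _). Qed.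

Lemma prod_sign_dist (n : nat) (a : pred 'I_n) :
  `|1 - \prod_(i < n) (-1) ^+ a i| <= \sum_(i < n) 2 * (a i)%:R :> int.
Proof.
have [/existsP[i ai]|/existsPn a0] := boolP [exists i, a i]; last first.
  by rewrite big1 ?subrr ?normr0 ?sumr_ge0// => i _; rewrite (negbTE (a0 i)).
rewrite (bigD1 i)//= ai; apply: (@le_trans _ _ 2); last first.
  by rewrite (bigD1 i)//= ai mulr1 lerDl sumr_ge0// => j _; rewrite mulr_ge0 ?ler0n.
rewrite (le_trans (ler_normB _ _))// normr1 normrM normr_prod.
by rewrite big1 ?mulr1// => j _; rewrite normr_sign.
Qed.

(** For each of the [k] factors at most one [n] hits the flipped position, so at most [k] summands
    change, each by at most 2. *)
Lemma corr_sum_flip k w (sm : 'I_S * 'I_N) (c : config N S k) :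
  `|corr_sum w c - corr_sum (flip sm w) c| <= 2 * k%:R :> int.
Proof.
case: sm c => s m [[M d] t]; rewrite /corr_sum -sumrB.
pose a n (i : 'I_k) := (t i == s) && (n + d i == m)%N.
apply: le_trans (ler_norm_sum _ _ _) _.
apply: (@le_trans _ _ (\sum_(n < M) \sum_(i < k) 2 * (a n i)%:R)).
  apply: ler_sum => n _; apply: le_trans (prod_sign_dist (a n)).
  under [X in _ - X]eq_bigr do rewrite esign_flip.
  rewrite big_split -{1}[X in X - _]mul1r -mulrBl normrM ler_piMr// normr_prod.
  by apply: prodr_ile1 => i; rewrite normr_ge0 normr_esign.
rewrite exchange_big -[k in leRHS]card_ord -sum1_card natr_sum mulr_sumr.
apply: ler_sum => i _; rewrite -mulr_sumr ler_pM2l// -natr_sum ler_nat.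
have [/existsP[n0 an]|/existsPn a0] := boolP [exists n : 'I_M, a n i]; last first.
  by rewrite big1// => n _; rewrite (negbTE (a0 n)).
rewrite (bigD1 n0)//= big1 ?addn0 ?leq_b1// => n nn0.
apply/eqP; rewrite eqb0; apply: contra nn0 => /andP[_ /eqP e].
by case/andP: an => _ /eqP; rewrite -e => /eqP; rewrite eqn_add2r eq_sym.
Qed.

Lemma Phi_flip k w (sm : 'I_S * 'I_N) : (Phi k w <= Phi k (flip sm w) + 2 * k)%N.
Proof.
apply/bigmax_leqP => c cadm.
apply: (@leq_trans (absz (corr_sum (flip sm w) c) + 2 * k)); last first.
  by rewrite leq_add2r; apply: leq_bigmax_cond.
have := corr_sum_flip w sm c; lia.
Qed.

Lemma flipK {I : finType} (i : I) : involutive (flip i).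
Proof. by move=> v; apply/ffunP => j; rewrite !ffunE -addbA addbb addbF. Qed.

Lemma Phi_lipschitz {R : realFieldType} k w (sm : 'I_S * 'I_N) :
  `|(Phi k w)%:R - (Phi k (flip sm w))%:R| <= (2 * k)%:R :> R.
Proof.
have h1 := Phi_flip k w sm; have h2 := Phi_flip k (flip sm w) sm.
rewrite flipK in h2; apply/ler_normlP.
by rewrite opprB !lerBlDl -!natrD !ler_nat.
Qed.

End Flip.

(** * The block-shaped families of shifts *)

Section Shifts.
Context {kap M b : nat}.
Implicit Types (x y : {ffun 'I_kap -> 'I_b}) (i j : 'I_kap).

(* Only shifts of this shape, one per block of length b, are used for the lower
   bound on the mean: the family x is free, the shifts increase automatically,
   and the positions below M are met by the first shift only. *)
Definition shift x (i : 'I_kap.+1) : nat :=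
  if unlift ord0 i is Some j then (M + j * b + x j)%N else 0%N.

Lemma shift0 x : shift x ord0 = 0%N.
Proof. by rewrite /shift unlift_none. Qed.

Lemma shiftS x j : shift x (lift ord0 j) = (M + j * b + x j)%N.
Proof. by rewrite /shift liftK. Qed.

Lemma block_lt x y i j : (i < j)%N -> (i * b + x i < j * b + y j)%N.
Proof.
move=> ij; have : (i.+1 * b <= j * b)%N by rewrite leq_mul2r ij orbT.
by have := ltn_ord (x i); rewrite mulSn; lia.
Qed.

Lemma shift_lt x (i j : 'I_kap.+1) : (0 < M)%N -> (i < j)%N -> (shift x i < shift x j)%N.
Proof.
move=> M0; rewrite {2}/shift; case: unliftP => [j' ->|->//].
rewrite /shift; case: unliftP => [i' ->|-> _]; last by rewrite -addnA ltn_addr.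
by rewrite /= !/bump /= !add1n ltnS -!addnA ltn_add2l; exact: block_lt.
Qed.

Lemma shift_ub x (i : 'I_kap.+1) : (shift x i <= M + kap * b)%N.
Proof.
rewrite /shift; case: unliftP => [j _|//]; rewrite -addnA leq_add2l.
have : (j.+1 * b <= kap * b)%N by rewrite leq_mul2r ltn_ord orbT.
by have := ltn_ord (x j); rewrite mulSn; lia.
Qed.

(** The factor acquired by the product of signs at the positions [n + shift x i] when the sign at
    [m] is flipped. *)
Definition flip_sign x (n m : nat) : int :=
  \prod_(i < kap.+1) (-1) ^+ (n + shift x i == m)%N.

Lemma flip_sign_low x n m : (m < M)%N -> flip_sign x n m = (-1) ^+ (n == m).
Proof.
move=> mM; rewrite /flip_sign big_ord_recl shift0 addn0 big1 ?mulr1// => j _.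
by rewrite shiftS (_ : (_ == m) = false)//; lia.
Qed.

(** Take the last block [i] where [x] and [y] differ, and let [m] be the position that the larger of
    the two shifts reaches from [n0]. Later shifts coincide and cancel; all others fall short of [m]
    for every [n <= n0]. *)
Lemma flip_sign_pair x y n0 : x != y -> (n0 < M)%N ->
  exists2 m, (m < M + M + kap * b)%N &
    forall n, (n <= n0)%N -> flip_sign x n m * flip_sign y n m = (-1) ^+ (n == n0).
Proof.
move=> xy n0M; have [i0 xyi0] : exists i, x i != y i.
  apply/existsP; apply: contraNT xy; rewrite negb_exists => /forallP e.
  by apply/eqP/ffunP => i; apply/eqP; rewrite -[_ == _]negbK e.
case: (arg_maxnP (P := fun i => x i != y i) (fun i => nat_of_ord i) xyi0) => i xyi imax.
have {imax} eq_above j : (i < j)%N -> x j = y j.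
  by move=> ij; apply/eqP; apply: contraTT ij => /imax; rewrite -leqNgt.
wlog yx : x y xy xyi0 xyi eq_above / (y i < x i)%N.
  move=> H; case: (ltngtP (y i) (x i)) => yx; first exact: (H x y).
    have [||||//|m mM mP] := H y x; rewrite 1?eq_sym//.
      by move=> j /eq_above.
    by exists m => // n /mP; rewrite mulrC.
  by move: xyi; rewrite (ord_inj yx) eqxx.
exists (n0 + (M + i * b + x i))%N.
  have := shift_ub x (lift ord0 i); rewrite shiftS; lia.
move=> n nn0; rewrite -big_split big_ord_recl /= (bigD1 i)//= !shift0 !shiftS.
rewrite !addn0 (_ : (n == _ + _)%N = false); last by lia.
rewrite (_ : (n + _ == n0 + _)%N = (n == n0)); last by lia.
rewrite (_ : (n + (_ + y i) == _ + _)%N = false); last by lia.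
rewrite big1 ?mulr1 ?mul1r// => j ji.
have [ij|] := ltnP i j; first by rewrite !shiftS eq_above// -expr2 sqrr_sign.
rewrite leq_eqVlt (negbTE ji : (nat_of_ord j == i) = false) /= => lt_ji.
have h1 := block_lt x x lt_ji; have h2 := block_lt y x lt_ji.
have offm u : (u < i * b + x i)%N -> (n + (M + u) == n0 + (M + (i * b + x i)))%N = false by lia.
by rewrite !shiftS -!addnA !offm ?mulr1.
Qed.

End Shifts.
Arguments shift {kap} M {b}.
Arguments flip_sign {kap} M {b}.

(** * Cutting the window into [r] blocks of length [q] *)

Section Positions.
Context {r q : nat}.

Definition pos (n : 'I_r * 'I_q) : nat := (n.1 * q + n.2)%N.

Lemma pos_lt n : (pos n < r * q)%N.
Proof.
have : (n.1.+1 * q <= r * q)%N by rewrite leq_mul2r ltn_ord orbT.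
by rewrite /pos mulSn; have := ltn_ord n.2; lia.
Qed.

Lemma pos_inj : injective pos.
Proof.
move=> [a c] [a' c'] e; have q0 : (0 < q)%N by rewrite (leq_trans _ (ltn_ord c)).
have ea : a = a'.
  apply: ord_inj; have := congr1 (divn^~ q) e.
  by rewrite /pos !divnMDl// !divn_small// !addn0.
rewrite ea in e *; congr pair; apply: ord_inj.
by move/eqP: e; rewrite /pos eqn_add2l => /eqP.
Qed.

Lemma sum_pos {V : nmodType} (F : nat -> V) :
  \sum_(n < r * q) F n = \sum_(j < r) \sum_(l < q) F (pos (j, l)).
Proof.
rewrite -(big_mkord xpredT) big_nat_mul big_mkord; apply: eq_bigr => j _.
rewrite mulSn -{1}[(j * q)%N]add0n big_addn addnK big_mkord.
by apply: eq_bigr => l _; rewrite addnC.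
Qed.

End Positions.

(** * Lower bound on the mean of the correlation measure *)

Section LowerBound.
Context {R : rcfType} {N S kap r q b : nat} (s0 : 'I_S).
Implicit Types (w : signfam N S) (x y : {ffun 'I_kap -> 'I_b}).
Local Notation M := (r * q)%N.
Context (fits : (M + M + kap * b <= N)%N).

Definition term x (n : nat) w : int := \prod_(i < kap.+1) esign w s0 (n + shift M x i).

Lemma shift_fits x i n : (n < M)%N -> (n + shift M x i < N)%N.
Proof. by move=> nM; have := shift_ub (M := M) x i; move: fits; lia. Qed.

Lemma term_flip x n (m : 'I_N) w :
  term x n (flip (s0, m) w) = flip_sign M x n m * term x n w.
Proof.
rewrite /term /flip_sign -big_split; apply: eq_bigr => i _.
by rewrite esign_flip eqxx.
Qed.

Lemma sgb_term x n w : (n < M)%N -> sgb (0 < term x n w) = (term x n w)%:~R :> R.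
Proof.
move=> nM; have : term x n w ^+ 2 = 1.
  by rewrite /term -prodrXl big1// => i _; rewrite esign_sqr// shift_fits.
by move/eqP; rewrite sqrf_eq1 => /orP[] /eqP ->; rewrite /sgb//= mulrN1z.
Qed.

(** The inner [[ffun l => v (j, l)] l] is left unreduced so that [mean_forall_rows] matches. *)
Definition all_blocks (v : {ffun 'I_r * 'I_q -> bool}) : bool :=
  [forall j, (Num.sqrt q%:R / 2 <= \sum_l sgb ([ffun l => v (j, l)] l) :> R)].

Definition event x w : bool := all_blocks [ffun n => 0 < term x (pos n) w].

Definition block_prob : R :=
  mean (fun y : {ffun 'I_q -> bool} => (Num.sqrt q%:R / 2 <= \sum_l sgb (y l) :> R)%R%:R).

Lemma mean_all_blocks : mean (fun v => (all_blocks v)%:R) = block_prob ^+ r.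
Proof.
rewrite -[in RHS](card_ord r).
exact: (mean_forall_rows _ (fun y : {ffun 'I_q -> bool} =>
         (Num.sqrt q%:R / 2 <= \sum_l sgb (y l) :> R))).
Qed.

(** Flipping the sign at [m] negates the whole product. The families [xs] and [ps] are general so as
    to serve both a single choice of shifts and a pair of choices. *)
Lemma mean_sign_prod0 (J : finType) (X : {set J}) (xs : J -> {ffun 'I_kap -> 'I_b})
    (ps : J -> 'I_r * 'I_q) m : (m < N)%N ->
  \prod_(j in X) flip_sign M (xs j) (pos (ps j)) m = -1 ->
  mean (fun w => \prod_(j in X) sgb (0 < term (xs j) (pos (ps j)) w)) = 0 :> R.
Proof.
move=> mN eX; apply: (@mean_odd _ _ (s0, Ordinal mN)) => w.
have toint v : \prod_(j in X) sgb (0 < term (xs j) (pos (ps j)) v) =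
    (\prod_(j in X) term (xs j) (pos (ps j)) v)%:~R :> R.
  by rewrite rmorph_prod; apply: eq_bigr => j _; rewrite sgb_term// pos_lt.
rewrite !toint; under eq_bigr do rewrite term_flip.
by rewrite big_split /= eX mulN1r rmorphN.
Qed.

(** For [n] in [X], the sign at [pos n] itself enters exactly one term of the product, through the
    zero shift. *)
Lemma mean_event x : mean (fun w => (event x w)%:R) = block_prob ^+ r.
Proof.
rewrite -mean_all_blocks; apply: mean_uniform => X /set0Pn[n nX].
have nM := pos_lt n; apply: (@mean_sign_prod0 _ X (fun=> x) id (pos n)).
  by move: fits; lia.
rewrite (bigD1 n)//= flip_sign_low// eqxx big1 ?mulr1// => n' /andP[_ ne].
by rewrite flip_sign_low// (inj_eq pos_inj) (negbTE ne).
Qed.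

(* A low position occurring in only one of the two products is flipped;
   otherwise the products combine pairwise, and the last occurring position
   of the symmetric difference of the shifts is flipped. *)
Lemma mean_event2 x y : x != y ->
  mean (fun w => (event x w && event y w)%:R) = (block_prob ^+ r) ^+ 2.
Proof.
move=> xy; rewrite -mean_all_blocks -card_bool -mean_forall_rows.
pose xs (j : bool * ('I_r * 'I_q)) := if j.1 then x else y.
pose Y j w := 0 < term (xs j) (pos j.2) w.
rewrite -(mean_uniform (Y := Y)) => [|X X0].
  apply: eq_mean => w; congr ((nat_of_bool _)%:R); apply/andP/forallP => [[ex ey] c|H].
    rewrite (_ : [ffun _ => _] = [ffun n => 0 < term (xs (c, n)) (pos n) w]).
      by case: c.
    by apply/ffunP => n; rewrite !ffunE.
  by split; [move: (H true)|move: (H false)]; congr all_blocks; apply/ffunP => n;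
    rewrite !ffunE.
have [/existsP[n Xn]|/existsPn Xn] :=
    boolP [exists n, ((true, n) \in X) != ((false, n) \in X)].
  have nM := pos_lt n; apply: (@mean_sign_prod0 _ X xs snd (pos n)).
    by move: fits; lia.
  pose c := (true, n) \in X; have cX : (c, n) \in X.
    by move: Xn; rewrite /c; case e: ((true, n) \in X) => //=; case: (_ \in X).
  rewrite (bigD1 (c, n))//= [flip_sign _ (xs (c, n)) _ _]flip_sign_low// eqxx big1 ?mulr1// => -[c' n'] /andP[jX ne].
  rewrite flip_sign_low// (inj_eq pos_inj) /=; case: eqP => // en.
  move: Xn jX ne cX; rewrite {n'}en xpair_eqE eqxx andbT.
  by case: c; case: c' => //; do 2!case: (_ \in X).
have {}Xn n : ((true, n) \in X) = ((false, n) \in X).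
  by apply/eqP; have := Xn n; rewrite negbK.
have [n1 n1X] : exists n, (true, n) \in X.
  by case/set0Pn: X0 => -[[] n] nX; exists n => //; rewrite Xn.
(* [flip_sign_pair] controls only the positions up to [n0], hence the maximal choice. *)
case: (arg_maxnP (P := fun n => (true, n) \in X) pos n1X) => n0 n0X n0max.
have [m mb mP] := flip_sign_pair xy (pos_lt n0).
apply: (@mean_sign_prod0 _ X xs snd m); first by move: fits; lia.
have -> : \prod_(j in X) flip_sign M (xs j) (pos j.2) m =
    \prod_c \prod_n (if (c, n) \in X then flip_sign M (xs (c, n)) (pos n) m else 1).
  by rewrite pair_bigA big_mkcond; apply: eq_bigr => -[].
rewrite big_bool -big_split /=.
rewrite (bigD1 n0)//= -Xn n0X mP// eqxx big1 ?mulr1// => n ne.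
rewrite -Xn; case: ifP => [nX|_]; last by rewrite mulr1.
rewrite mP; first by rewrite (inj_eq pos_inj) (negbTE ne).
exact: n0max.
Qed.

Context (r0 : (0 < r)%N) (q0 : (0 < q)%N).

(** All indices use the sequence [s0]; strictly increasing shifts make the configuration admissible,
    and its sum splits into [r] blocks of at least [sqrt q / 2] each. *)
Lemma event_Phi x w : event x w -> r%:R * (Num.sqrt q%:R / 2) <= (Phi kap.+1 w)%:R :> R.
Proof.
move=> /forallP ev; have M0 : (0 < M)%N by rewrite muln_gt0 r0.
have MN : (M < N.+1)%N by move: fits; lia.
pose d : {ffun 'I_kap.+1 -> 'I_N} := [ffun i => Ordinal (shift_fits x i M0)].
pose c : config N S kap.+1 := (Ordinal MN, d, [ffun=> s0]).
have dE i : d i = shift M x i :> nat by rewrite ffunE.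
have cadm : admissible c.
  rewrite /admissible /= M0 /=; apply/and3P; split.
  - apply/forallP => i; apply/forallP => j; apply/implyP; rewrite !dE leq_eqVlt.
    by case/orP => [/eqP/ord_inj->//|ij]; rewrite ltnW// shift_lt.
  - apply/forallP => i; rewrite dE; have := shift_ub (M := M) x i; move: fits; lia.
  - apply/forallP => i; apply/forallP => j; apply/implyP => /andP[+ _].
    rewrite -!(inj_eq (@ord_inj _)) !dE neq_ltn => /orP[] ij; rewrite neq_ltn.
      by rewrite shift_lt.
    by rewrite (shift_lt x M0 ij) orbT.
apply: (@le_trans _ _ (absz (corr_sum w c))%:R); last first.
  by rewrite ler_nat; apply: leq_bigmax_cond.
apply: (@le_trans _ _ (corr_sum w c)%:~R); last first.
  by rewrite -[leRHS]mulrz_nat natz ler_int lez_abs.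
have -> : corr_sum w c = \sum_(n < M) term x n w.
  by apply: eq_bigr => n _; apply: eq_bigr => i _; rewrite dE ffunE.
rewrite (sum_pos (fun n => term x n w)) rmorph_sum -[r in leLHS]card_ord -sum1_card natr_sum mulr_suml.
apply: ler_sum => j _; rewrite mul1r rmorph_sum; apply: le_trans (ev j) _.
apply: ler_sum => l _; rewrite !ffunE sgb_term// pos_lt//.
Qed.

(** The hypothesis makes the expected number of events at least 4, so none occurs with probability
    at most [1/4]. *)
Lemma mean_Phi_lb : 4 * 16 ^+ r <= b%:R ^+ kap :> R ->
  3 / 4 * (r%:R * (Num.sqrt q%:R / 2)) <= mean (fun w : signfam N S => (Phi kap.+1 w)%:R) :> R.
Proof.
move=> many; set t := r%:R * _.
have t0 : 0 <= t by rewrite mulr_ge0// divr_ge0// sqrtr_ge0.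
have := second_moment (cube_gt0 _) mean_event mean_event2.
set none := mean _ => sm.
have bp : 1/16 <= block_prob by have := @small_ball R 'I_q; rewrite card_ord; exact.
have p16 : (1/16) ^+ r <= block_prob ^+ r.
  by rewrite lerXn2r ?nnegrE ?(le_trans _ bp)// divr_ge0.
have none0 : 0 <= none by apply: mean_ge0.
have none4 : 4 * none <= 1.
  apply: le_trans sm; apply: ler_wpM2r => //.
  rewrite card_ffun !card_ord natrX; apply: le_trans (ler_pM _ _ many p16).
  - by rewrite -mulrA -exprMn mul1r divff ?expr1n ?mulr1// pnatr_eq0.
  - by rewrite mulr_ge0 ?exprn_ge0.
  - by rewrite exprn_ge0 ?divr_ge0.
have -> : 3 / 4 * t = t * 1 - t * (1/4) by field.
apply: (@le_trans _ _ (t * 1 - t * none)).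
  by rewrite lerD2l lerN2; apply: ler_wpM2l => //; lra.
rewrite -[X in t * X - _](mean_cst 1 (cube_gt0 ('I_S * 'I_N)%type)) -!meanZ.
rewrite -[- mean _]mulN1r -meanZ -meanD; apply: ler_mean => w.
have [/existsP[x ev]|/existsPn no] := boolP [exists x, event x w].
  rewrite (_ : [forall _, _] = false); last by apply/negbTE/forallPn; exists x; rewrite negbK.
  by rewrite mulr0 mulr0 addr0 mulr1 (event_Phi ev).
rewrite (_ : [forall _, _] = true); last by apply/forallP.
by rewrite mulr1 mulN1r subrr.
Qed.

End LowerBound.

(** * Smallness of [k] compared with [log N] *)

Lemma eventually_small_order (R : realType) (S : nat) (k : nat -> nat) (D C : nat) :
  (0 < S)%N -> (1 < D)%N -> (0 < C)%N ->
  (forall N : nat, (3 <= N)%N ->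
     (k N)%:R <= (ln (N%:R : R) + ln (S%:R : R)) / ln (ln (N%:R : R))) ->
  exists N0 : nat, [/\ (3 <= N0)%N, 12 * (ln (S%:R : R) / ln 2) <= N0%:R &
    forall N : nat, (N0 <= N)%N -> (C * k N <= trunc_log D N)%N].
Proof.
move=> S0 D1 C0 kS; set l := ln (D%:R : R).
have l0 : 0 < l by rewrite ln_gt0// ltr1n.
(* Once [ln (ln N) >= B], [k B <= 2 ln N]. The 4 pays for [ln S <= ln N] and for rounding in
   [trunc_log], each costing a factor 2. *)
pose B : R := 4 * C%:R * l + 1.
have C1 : 1 <= C%:R :> R by rewrite ler1n.
have B0 : 0 < B by rewrite /B; nra.
have lnS : 0 <= ln (S%:R : R) by rewrite ln_ge0// ler1n.
have S12 : 0 <= 12 * (ln (S%:R : R) / ln 2) by rewrite mulr_ge0// divr_ge0// ln_ge0// ler1n.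
(* The summands ensure in turn [N >= 3], [S <= N], [ln (ln N) >= B] and [N0 >= 12 log_2 S]. *)
exists (3 + S + Num.bound (expR (expR B)) + Num.bound (12 * (ln (S%:R : R) / ln 2)))%N.
split; first by rewrite -!addnA leq_addr.
  by rewrite (le_trans (ltW (archi_boundP S12)))// ler_nat leq_addl.
move=> N NN0; have N3 : (3 <= N)%N by lia.
have SN : (S <= N)%N by lia.
have BN : (Num.bound (expR (expR B)) <= N)%N by lia.
have N0 : 0 < N%:R :> R by rewrite ltr0n; lia.
set L := ln (N%:R : R).
have BL : expR B <= L.
  rewrite -[expR B]expRK ler_ln ?posrE ?expR_gt0//.
  by rewrite (le_trans (ltW (archi_boundP (expR_ge0 _))))// ler_nat.
have L0 : 0 < L by rewrite (lt_le_trans (expR_gt0 B)).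
have BlnL : B <= ln L by rewrite -[B]expRK ler_ln ?posrE ?expR_gt0.
have lnSL : ln (S%:R : R) <= L by rewrite ler_ln ?posrE ?ltr0n ?ler_nat//; lia.
have L2 : 2 * l <= L by have := expR_ge1Dx B; rewrite /B in BL *; nra.
have kL : (k N)%:R * B <= 2 * L.
  have := kS N N3; rewrite -/L ler_pdivlMr ?(lt_le_trans B0)// => h.
  have k0 : 0 <= (k N)%:R :> R by [].
  by nra.
have La : L <= (trunc_log D N).+1%:R * l.
  have D0 : 0 < D%:R :> R by rewrite ltr0n ltnW.
  rewrite mulrC mulr_natr -lnXn// ler_ln ?posrE ?exprn_gt0//.
  by rewrite -natrX ler_nat ltnW// trunc_log_ltn.
rewrite -(ler_nat R) natrM -(ler_pM2r l0).
rewrite -natr1 in La; have k0 : 0 <= (k N)%:R :> R by [].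
by rewrite /B in kL; nra.
Qed.

(** * Choice of parameters and conclusion *)

Lemma prob_mean (R : realType) N S (P : pred (signfam N S)) :
  prob R P = mean (fun w => (P w)%:R).
Proof.
rewrite /prob /mean; congr (_ / _); rewrite -sum1_card natr_sum big_mkcond.
by apply: eq_bigr => w _; rewrite inE; case: (P w).
Qed.

Lemma expect_Phi_lb (R : realType) N S kap a : (0 < S)%N -> (0 < kap)%N ->
  (kap <= a)%N -> (16 ^ a * 16 ^ a <= N)%N ->
  0 < expect (fun w : signfam N S => (Phi kap.+1 w)%:R : R) /\
  (kap * a * N)%:R / 64 <= expect (fun w : signfam N S => (Phi kap.+1 w)%:R : R) ^+ 2.
Proof.
move=> S0 kap0 kap_a aN; set E := expect _.
have a0 : (0 < a)%N by exact: leq_trans kap_a.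
have a16 : (8 * a <= 16 ^ a)%N.
  by elim: (a) a0 => // -[//|n] IH _; rewrite expnS; have := IH isT; lia.
(* Here [2 r q <= N / 2] and [kap b <= N / 2], so everything fits in [N], while
   [b ^ kap = 4 ^ kap * 16 ^ r] supplies enough choices. *)
pose r := (kap * a)%N; pose q := (N %/ (4 * r))%N; pose b := (4 * 16 ^ a)%N.
have r0 : (0 < r)%N by rewrite muln_gt0 kap0.
have rN : (8 * r <= N)%N.
  apply: leq_trans aN; apply: leq_trans (leq_mul a16 a16).
  have : (kap * a <= a * a)%N by rewrite leq_mul2r kap_a orbT.
  by rewrite /r; nia.
have qr : (4 * r * q <= N)%N by rewrite mulnC leq_trunc_div.
have Nqr : (N <= 8 * (r * q))%N.
  have := ltn_ceil N (_ : 0 < 4 * r)%N; rewrite -/q; move=> /(_ ltac:(lia)); nia.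
have q0 : (0 < q)%N by rewrite divn_gt0; lia.
have kb : (2 * (kap * b) <= N)%N.
  apply: leq_trans aN; have : (8 * kap <= 16 ^ a)%N by apply: leq_trans a16; lia.
  by move=> h; apply: leq_trans (leq_mul h (leqnn _)); rewrite /b; nia.
have fits : (r * q + r * q + kap * b <= N)%N by nia.
have many : 4 * 16 ^+ r <= b%:R ^+ kap :> R.
  rewrite /b natrM natrX exprMn -exprM mulnC -/r ler_wpM2r ?exprn_ge0//.
  by rewrite -[leLHS]expr1 ler_weXn2l// ler1n.
have := mean_Phi_lb (Ordinal S0) fits r0 q0 many.
rewrite -/E; set e0 := 3 / 4 * _ => e0E.
have q0' : 0 < q%:R :> R by rewrite ltr0n.
have e0_gt0 : 0 < e0.
  by rewrite /e0 !mulr_gt0 ?invr_gt0 ?sqrtr_gt0 ?ltr0n.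
split; first exact: lt_le_trans e0E.
apply: (@le_trans _ _ (e0 ^+ 2)); last by rewrite ler_pXn2r ?nnegrE ?(le_trans (ltW e0_gt0))// ltW.
(* As [r q >= N / 8], this is at least [9/512 r N], above the claimed [r N / 64]. *)
have -> : e0 ^+ 2 = 9 / 64 * (r%:R * (r * q)%:R).
  by rewrite /e0 !exprMn natrM -[q%:R in RHS]sqr_sqrtr ?ltW//; field.
have : N%:R <= 8 * (r * q)%:R :> R by rewrite -natrM ler_nat.
have : 0 < r%:R :> R by rewrite ltr0n.
rewrite natrM -/r; nra.
Qed.

Lemma variance_Phi (R : realType) N S k :
  mean (fun w : signfam N S => (Phi k w)%:R ^+ 2 : R)
    - mean (fun w : signfam N S => (Phi k w)%:R) ^+ 2 <= (S * N * k ^ 2)%:R.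
Proof.
apply: le_trans (variance_bound (c := (2 * k)%:R) _) _ => [i w|].
  exact: Phi_lipschitz.
by rewrite card_prod !card_ord !natrM; lra.
Qed.

Theorem theorem2 (R : realType) (S : nat) (eps : R) (k : nat -> nat) :
  (0 < S)%N -> 0 < eps ->
  (forall N : nat, (3 <= N)%N ->
     (2 <= k N)%N /\
     (k N)%:R <= (ln (N%:R : R) + ln (S%:R : R)) / ln (ln (N%:R : R))) ->
  exists N0 : nat,
    12 * (ln (S%:R : R) / ln 2) <= N0%:R /\
    forall N : nat, (N0 <= N)%N ->
      1 - eps <=
        prob R (fun w : signfam N S =>
          let E := expect (fun w' : signfam N S => (Phi (k N) w')%:R : R) in
          (1 - eps < (Phi (k N) w)%:R / E) && ((Phi (k N) w)%:R / E < 1 + eps)).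
Proof.
move=> S0 e0 kP.
have C0 : 0 <= 128 * S%:R / eps ^+ 3 by rewrite divr_ge0 ?exprn_ge0 ?mulr_ge0// ltW.
(* Chebyshev needs [S N k^2 <= eps^3 E^2], where [E^2 >= (k - 1) a N / 64]. As [k <= 2 (k - 1)], it
   suffices that [128 S k <= eps^3 a], which follows from [C k <= a]. The successor keeps [C]
   positive. *)
pose C := (Num.bound (128 * S%:R / eps ^+ 3)).+1.
have CP : 128 * S%:R <= C%:R * eps ^+ 3.
  rewrite -ler_pdivrMr ?exprn_gt0// (le_trans (ltW (archi_boundP C0)))//.
  by rewrite ler_nat leqnSn.
(* The base [16 * 16] gives [16 ^ a * 16 ^ a <= N] for the truncated logarithm [a]. *)
have [N0 [N03 S12 small]] := eventually_small_order (D := 16 * 16) S0 isT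
  (ltn0Sn _ : 0 < C)%N (fun N h => proj2 (kP N h)).
exists N0; split=> // N NN0; have N3 := leq_trans N03 NN0.
have [k2 _] := kP N N3; have := small N NN0.
(* Writing [k = kap + 2] leaves [kap + 1 >= 1] free shifts after the first. *)
move: (k N) k2 => [|[|kap]]// _; set a := trunc_log _ _; set kk := kap.+2 => Cka.
have kap_a : (kap.+1 <= a)%N by rewrite (leq_trans _ Cka)// /kk /C mulSn; lia.
have aN : (16 ^ a * 16 ^ a <= N)%N by rewrite -expnMn trunc_logP//; lia.
have [E0 E2] := expect_Phi_lb R S0 (ltn0Sn kap) kap_a aN.
rewrite -/kk in E0 E2; set E := expect _ in E0 E2.
rewrite prob_mean /= -/E; have eE0 : 0 < eps * E by rewrite mulr_gt0.
have := chebyshev (fun w : signfam N S => (Phi kk w)%:R) (cube_gt0 _) eE0.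
rewrite -[mean (fun w => (Phi _ w)%:R)]/E => cheb; apply: le_trans (le_trans cheb _); last first.
  apply: ler_mean => w; rewrite ler_nat; case: ltr_normlP => // -[h1 h2].
  by rewrite ltr_pdivlMr// ltr_pdivrMr// mulrBl mulrDl mul1r; case: andP => // -[]; split; lra.
rewrite lerD2l lerN2 ler_pdivrMr ?exprn_gt0//.
apply: le_trans (variance_Phi R N S kk) _.
have -> : eps * (eps * E) ^+ 2 = eps ^+ 3 * E ^+ 2 by ring.
have e3 : 0 < eps ^+ 3 by rewrite exprn_gt0.
apply: le_trans (ler_wpM2l (ltW e3) E2).
rewrite -(ler_nat R) natrM in Cka.
have k2 : kk%:R <= 2 * kap.+1%:R :> R by rewrite -natrM ler_nat /kk; lia.
have main : 128 * S%:R * kk%:R <= eps ^+ 3 * a%:R.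
  apply: le_trans (ler_wpM2l (ltW e3) Cka); rewrite mulrA ler_wpM2r//.
  by rewrite [leRHS]mulrC.
have kN0 : 0 <= kap.+1%:R * N%:R :> R by rewrite mulr_ge0.
have := ler_wpM2l kN0 main.
have := ler_wpM2l (mulr_ge0 (mulr_ge0 (ler0n R S) (ler0n R N)) (ler0n R kk)) k2.
rewrite !natrM; lra.
Qed.
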